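(* Consider the two-step finite volume scheme for the shallow water equations described in the context, with $\mathbf U_{ij}^n$ the cell values of $(h,hu,hv)$ at time $t_n$. Suppose that the values $(\hat h,\hat u,\hat v)$ given by the predictor step satisfy, for all $i,j\in\mathbb Z$ and all $i',j'\in\{0,\pm\frac12\}$, (1) $\hat u=0$ at all edge quadrature nodes; (2) $\delta_y^{i+i',j}\,\hat v_{i+i',j}=0$, i.e. $\hat v_{i+i',j+\frac12}=\hat v_{i+i',j-\frac12}$; (3) $\hat v_{i+i',j\pm\frac12}\;\delta_y^{i+i',j}\,\hat h_{i+i',j}=0$; (4) $\delta_x^{i,j+j'}\,\hat K_{i,j+j'}=0$, where $\hat K=g(\hat h+b-\hat V)$; (5) $\delta_y^{i+i',j}\,(\hat h_{i+i',j}+b_{i+i',j})=0$. Then the finite volume scheme preserves the lake at rest and the jet in the rotating frame, i.e. the finite volume update yields $\mathbf U_{ij}^{n+1}=\mathbf U_{ij}^n$ for all $i,j$.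
   Context: Shallow water equations: $\mathbf u_t+\mathbf f_1(\mathbf u)_x+\mathbf f_2(\mathbf u)_y=\mathbf b(\mathbf u)$ with $\mathbf u=(h,hu,hv)^T$, $\mathbf f_1=(hu,\;hu^2+\frac12gh^2,\;huv)^T$, $\mathbf f_2=(hv,\;huv,\;hv^2+\frac12gh^2)^T$, $\mathbf b=(0,\;-ghb_x+fhv,\;-ghb_y-fhu)^T$. Here $h$ is the water depth, $(u,v)$ the velocity, $b(x,y)$ the bottom topography, $g>0$ the gravitational constant, $f$ the Coriolis parameter. Equilibria considered: stationary states with $u=0$, $v_y=0$, $vh_y=0$, $g(h+b)_x=fv$, $g(h+b)_y=0$. Where $v=0$ this is the lake at rest ($h+b$ constant); where $v\ne0$ it is the jet in the rotating (rotational) frame. ''The scheme preserves'' such a state means that the cell values do not change in the finite volume update. Mesh: cells $\Omega_{ij}=[x_{i-\frac12},x_{i+\frac12}]\times[y_{j-\frac12},y_{j+\frac12}]$, $i,j\in\mathbb Z$, squares of side $\hbar$; time step $\Delta t$, $\lambda=\Delta t/\hbar$. Quadrature nodes on the edges: $(x_{i\pm\frac12},y_{j+j'})$ and $(x_{i+i'},y_{j\pm\frac12})$ with $i',j'\in\{0,\pm\frac12\}$; quadrature weights $\omega_{i'},\omega_{j'}$ (e.g. midpoint, trapezoidal or Simpson rule). A predictor step supplies values $(\hat h,\hat u,\hat v)$ at all these nodes (approximations at time $t_n+\Delta t/2$). $b_{k\ell}=b(x_k,y_\ell)$ (also written $\hat b$). Difference and average operators: $\delta_x^{k,\ell}a_{k,\ell}=a_{k+\frac12,\ell}-a_{k-\frac12,\ell}$,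 $\mu_x^{k,\ell}a_{k,\ell}=\frac12(a_{k+\frac12,\ell}+a_{k-\frac12,\ell})$, and $\delta_y^{k,\ell}a_{k,\ell}=a_{k,\ell+\frac12}-a_{k,\ell-\frac12}$, $\mu_y^{k,\ell}a_{k,\ell}=\frac12(a_{k,\ell+\frac12}+a_{k,\ell-\frac12})$. Discrete primitives $\hat U,\hat V$ of the Coriolis forces are defined at the nodes by $\delta_x^{i,j+j'}\hat V_{i,j+j'}=\hbar\frac fg\,\mu_x^{i,j+j'}\hat v_{i,j+j'}$ and $\delta_y^{i+i',j}\hat U_{i+i',j}=\hbar\frac fg\,\mu_y^{i+i',j}\hat u_{i+i',j}$. Finite volume update: $$\mathbf U_{ij}^{n+1}=\mathbf U_{ij}^n-\lambda\sum_{j'}\omega_{j'}\,\delta_x^{i,j+j'}\mathbf f_1(\hat h,\hat u,\hat v)_{i,j+j'}-\lambda\sum_{i'}\omega_{i'}\,\delta_y^{i+i',j}\mathbf f_2(\hat h,\hat u,\hat v)_{i+i',j}+\lambda\,\mathbf B_{ij},$$ where $\mathbf f_k(\hat h,\hat u,\hat v)$ denotes the flux evaluated at the primitive variables $(\hat h,\hat u,\hat v)$ and $$\mathbf B_{ij}=-g\begin{pmatrix}0\\ \sum_{j'}\omega_{j'}\,(\mu_x^{i,j+j'}\hat h_{i,j+j'})\,(\delta_x^{i,j+j'}(b-\hat V)_{i,j+j'})\\ \sum_{i'}\omega_{i'}\,(\mu_y^{i+i',j}\hat h_{i+i',j})\,(\delta_y^{i+i',j}(b+\hat U)_{i+i',j})\end{pmatrix}.$$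 *)

(* Defs.v *)
From mathcomp Require Import all_boot all_order all_algebra.
Set Implicit Arguments. Unset Strict Implicit. Unset Printing Implicit Defensive.
Import Order.TTheory GRing.Theory Num.Theory.
Local Open Scope ring_scope.

(* Half-integer indices are stored doubled: a node function a : grid V takes
   k, l : int and returns a_{k/2, l/2}.  The cell (i, j) has its centre at the
   doubled index (2 i, 2 j), and an offset in {0, 1/2, -1/2} becomes an element
   of [:: -1; 0; 1].  The edge quadrature nodes are the (k, l) with k or l odd;
   the values of a node function at the cell centres are junk, and the scheme
   never reads them.  Cell values, by contrast, are indexed by (i, j) itself. *)
Definition grid (V : Type) := int -> int -> V.

Definition offsets : seq int := [:: -1; 0; 1].
Definition signs : seq int := [:: -1; 1].

Definition delta_x (V : zmodType) (a : grid V) (k l : int) : V :=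
  a (k + 1) l - a (k - 1) l.
Definition delta_y (V : zmodType) (a : grid V) (k l : int) : V :=
  a k (l + 1) - a k (l - 1).

Section Scheme.
Variable R : realFieldType.

Definition mu_x (a : grid R) (k l : int) : R := (a (k + 1) l + a (k - 1) l) / 2.
Definition mu_y (a : grid R) (k l : int) : R := (a k (l + 1) + a k (l - 1)) / 2.

Definition vec3 (a b c : R) : 'cV[R]_3 := \col_(s < 3) [:: a; b; c]`_s.

(* The fluxes as functions of the primitive variables (h, u, v). *)
Definition flux1 (g h u v : R) : 'cV[R]_3 :=
  vec3 (h * u) (h * u ^+ 2 + 2^-1 * g * h ^+ 2) (h * u * v).
Definition flux2 (g h u v : R) : 'cV[R]_3 :=
  vec3 (h * v) (h * u * v) (h * v ^+ 2 + 2^-1 * g * h ^+ 2).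

(* (x0, y0) is the centre of the cell (0, 0). *)
Definition sample (hbar x0 y0 : R) (b : R -> R -> R) : grid R :=
  fun k l => b (x0 + k%:~R / 2 * hbar) (y0 + l%:~R / 2 * hbar).

Definition coriolis_primitive_V (hbar f g : R) (v V : grid R) : Prop :=
  forall i j m : int, m \in offsets ->
    delta_x V (2 * i) (2 * j + m) =
    hbar * (f / g) * mu_x v (2 * i) (2 * j + m).
Definition coriolis_primitive_U (hbar f g : R) (u U : grid R) : Prop :=
  forall i j m : int, m \in offsets ->
    delta_y U (2 * i + m) (2 * j) =
    hbar * (f / g) * mu_y u (2 * i + m) (2 * j).

Definition source (g : R) (w : int -> R) (b h U V : grid R) (i j : int)
    : 'cV[R]_3 :=
  - g *: vec3 0
    (\sum_(m <- offsets) w m * (mu_x h (2 * i) (2 * j + m) *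
       delta_x (fun k l => b k l - V k l) (2 * i) (2 * j + m)))
    (\sum_(m <- offsets) w m * (mu_y h (2 * i + m) (2 * j) *
       delta_y (fun k l => b k l + U k l) (2 * i + m) (2 * j))).

Definition fv_update (hbar dt g : R) (w : int -> R) (b h u v U V : grid R)
    (Un : int -> int -> 'cV[R]_3) (i j : int) : 'cV[R]_3 :=
  let lambda := dt / hbar in
  Un i j
  - lambda *: (\sum_(m <- offsets) w m *:
      delta_x (fun k l => flux1 g (h k l) (u k l) (v k l)) (2 * i) (2 * j + m))
  - lambda *: (\sum_(m <- offsets) w m *:
      delta_y (fun k l => flux2 g (h k l) (u k l) (v k l)) (2 * i + m) (2 * j))
  + lambda *: source g w b h U V i j.

End Scheme.

(* Main.v *)
(* With u = 0 the only flux differences left are the pressure terms, which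
   factor discretely as g (mu h) (delta h).  The topography and Coriolis terms
   of the source carry the same average mu h, and the equilibrium conditions
   make their difference equal to - delta h, so they cancel node by node. *)
Require Import Defs.
From mathcomp Require Import all_boot all_order all_algebra.
From mathcomp Require Import ring.
Import Order.TTheory GRing.Theory Num.Theory.
Local Open Scope ring_scope.

(** Only [2^-1 * g * h ^+ 2] survives when [u] vanishes on both edges; its jump is a difference of
    squares, and the factor 1/2 turns the sum of the two depths into [mu_x h]. *)
Lemma delta_x_flux1_still (R : realFieldType) (g : R) (h u v : grid R) (k l : int) :
  u (k + 1) l = 0 -> u (k - 1) l = 0 ->
  delta_x (fun k l => flux1 g (h k l) (u k l) (v k l)) k l =
  vec3 0 (g * (mu_x h k l * delta_x h k l)) 0.
Proof.
rewrite /delta_x /mu_x => -> ->.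
by apply/colP => -[[|[|[|//]]] lt_s]; rewrite !mxE /=; field.
Qed.

(* Either v = 0 or h is equal on both edges, so h v and h v^2 do not jump. *)
Lemma delta_y_flux2_still (R : realFieldType) (g : R) (h u v : grid R) (k l : int) :
  u k (l + 1) = 0 -> u k (l - 1) = 0 -> delta_y v k l = 0 ->
  v k (l + 1) * delta_y h k l = 0 ->
  delta_y (fun k l => flux2 g (h k l) (u k l) (v k l)) k l =
  vec3 0 0 (g * (mu_y h k l * delta_y h k l)).
Proof.
rewrite /delta_y /mu_y => -> -> /subr0_eq <- vh0.
have hv_eq : h k (l + 1) * v k (l + 1) = h k (l - 1) * v k (l + 1).
  by apply/eqP; rewrite -subr_eq0 -mulrBl mulrC vh0.
apply/colP => -[[|[|[|//]]] lt_s]; rewrite !mxE /=.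
- by rewrite hv_eq subrr.
- by rewrite !mulr0 !mul0r subrr.
- by rewrite !expr2 !mulrA hv_eq; field.
Qed.

Theorem theorem2p1 (R : realFieldType) (g f hbar dt x0 y0 : R)
    (topo : R -> R -> R) (w : int -> R)
    (h u v U V : grid R) (Un : int -> int -> 'cV[R]_3)
    (g_gt0 : 0 < g) (hbar_gt0 : 0 < hbar) (dt_gt0 : 0 < dt)
    (HV : coriolis_primitive_V hbar f g v V)
    (HU : coriolis_primitive_U hbar f g u U) :
  let b := sample hbar x0 y0 topo in
  let K := fun k l => g * (h k l + b k l - V k l) in
  (forall i j m s : int, m \in offsets -> s \in signs ->
     u (2 * i + s) (2 * j + m) = 0 /\ u (2 * i + m) (2 * j + s) = 0) ->
  (forall i j m : int, m \in offsets ->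
     delta_y v (2 * i + m) (2 * j) = 0) ->
  (forall i j m s : int, m \in offsets -> s \in signs ->
     v (2 * i + m) (2 * j + s) * delta_y h (2 * i + m) (2 * j) = 0) ->
  (forall i j m : int, m \in offsets ->
     delta_x K (2 * i) (2 * j + m) = 0) ->
  (forall i j m : int, m \in offsets ->
     delta_y (fun k l => h k l + b k l) (2 * i + m) (2 * j) = 0) ->
  forall i j : int,
    fv_update hbar dt g w b h u v U V Un i j = Un i j.
Proof.
move=> b K u0 dv0 vdh0 dK0 dhb0 i j.
have flux_x m : m \in offsets ->
    delta_x (fun k l => flux1 g (h k l) (u k l) (v k l)) (2 * i) (2 * j + m) =
    vec3 0 (g * (mu_x h (2 * i) (2 * j + m) * delta_x h (2 * i) (2 * j + m))) 0.
  move=> m_in; apply: delta_x_flux1_still.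
  (* The signs 1 and -1 select the two opposite edges of the cell. *)
  - by have [] := u0 i j m 1 m_in isT.
  - by have [] := u0 i j m (-1) m_in isT.
have flux_y m : m \in offsets ->
    delta_y (fun k l => flux2 g (h k l) (u k l) (v k l)) (2 * i + m) (2 * j) =
    vec3 0 0 (g * (mu_y h (2 * i + m) (2 * j) * delta_y h (2 * i + m) (2 * j))).
  move=> m_in; apply: delta_y_flux2_still.
  - by have [] := u0 i j m 1 m_in isT.
  - by have [] := u0 i j m (-1) m_in isT.
  - exact: dv0.
  - exact: vdh0.
have source_x m : m \in offsets ->
    delta_x (fun k l => b k l - V k l) (2 * i) (2 * j + m) =
    - delta_x h (2 * i) (2 * j + m).
  move=> m_in; have := dK0 i j m m_in; rewrite /delta_x /K -mulrBr => /eqP.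
  (* Since [g] is positive, it cancels from the jump of [K], so [h + b - V] has no jump. *)
  rewrite mulf_eq0 gt_eqF //= => /eqP dhbV0.
  by apply/eqP; rewrite -addr_eq0 -dhbV0; apply/eqP; ring.
have source_y m : m \in offsets ->
    delta_y (fun k l => b k l + U k l) (2 * i + m) (2 * j) =
    - delta_y h (2 * i + m) (2 * j).
  (* As [u] vanishes on both edges, its average is zero and the primitive [U] has no jump. *)
  move=> m_in; have := HU i j m m_in; rewrite /mu_y.
  have [_ ->] := u0 i j m 1 m_in isT; have [_ ->] := u0 i j m (-1) m_in isT.
  rewrite addr0 mul0r mulr0 => dU0.
  (* The right-hand side 0 is written as the jump of [h + b] plus the jump of [U]. *)
  apply/eqP; rewrite -addr_eq0 -[eqbRHS]addr0 -{1}(dhb0 i j m m_in) -dU0.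
  by rewrite /delta_y; apply/eqP; ring.
rewrite /fv_update -[RHS]addr0 -!addrA; congr (_ + _).
rewrite -!scalerN -!scalerDr /source.
(* The node identities hold for [m] in [offsets], hence the rewriting under sums with membership at
   hand. *)
rewrite (eq_big_seq _ (fun m m_in => congr1 (GRing.scale (w m)) (flux_x m m_in))).
rewrite (eq_big_seq _ (fun m m_in => congr1 (GRing.scale (w m)) (flux_y m m_in))).
rewrite (eq_big_seq _ (fun m m_in => congr1 (fun d => w m * (_ * d)) (source_x m m_in))).
rewrite (eq_big_seq _ (fun m m_in => congr1 (fun d => w m * (_ * d)) (source_y m m_in))).
rewrite /offsets !big_cons !big_nil.
(* In each momentum component, every weight multiplies a pressure jump and its opposite. *)
by apply/colP => -[[|[|[|//]]] lt_s]; rewrite !mxE /=; ring.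
Qed.
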